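(* Let $D$ be an integral domain and let $*$ be a star operation of finite type on $D$ such that $D$ is a $*$-VIFD and ${\rm Cl}_*(D)$ is a torsion group. Then $D$ is an AVFD.
   Context: Let $D$ be an integral domain with quotient field $K$. An overring of $D$ is a subring of $K$ containing $D$. $F(D)$ (resp. $f(D)$) is the set of nonzero fractional (resp. nonzero finitely generated fractional) ideals of $D$; for $A\in F(D)$, $A^{-1}=\{x\in K\mid xA\subseteq D\}$. A star operation on $D$ is a map $*:F(D)\to F(D)$, $A\mapsto A_*$, such that for all $A,B\in F(D)$ and nonzero $c\in K$: $A\subseteq A_*=(A_* )_*$; $A\subseteq B$ implies $A_*\subseteq B_*$; $(cA)_*=cA_*$; $D_*=D$. It is of finite type if $A_*=\bigcup_{C\in f(D),\,C\subseteq A}C_*$ for all $A\in F(D)$. A fractional $*$-ideal is an $I\in F(D)$ with $I_*=I$. $I\in F(D)$ is $*$-invertible if $(II^{-1})_*=D$. The $*$-invertible fractional $*$-ideals form an abelian group $T_*(D)$ under $(I,J)\mapsto(IJ)_*$, and ${\rm Cl}_*(D)$ is the quotient of $T_*(D)$ by the subgroup of nonzero principal fractional ideals. An ideal $I$ of $D$ is a valuation ideal if there is a valuation overring $V$ of $D$ with $IV\cap D=I$ ($D$ itself is allowed). A valuation element of $D$ is a nonzero nonunit $a\in D$ such that $aD$ is a valuation ideal. $D$ is a $*$-VIFD ($*$-valuation ideal factorization domain) if each nonzero principal ideal $I$ of $D$ can be written as $I=(\prod_{i=1}^n I_i)_*$ with $n\in\mathbb{N}$ and valuation ideals $I_i$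 of $D$. $D$ is an AVFD (almost valuation factorization domain) if for each nonzero nonunit $a\in D$ there is an $n\in\mathbb{N}$ (positive integer) such that $a^n$ is a finite product of valuation elements of $D$. *)

(* Defs.v *)
From HB Require Import structures.
From mathcomp Require Import all_boot all_order all_algebra.
From mathcomp Require Import boolp classical_sets.

Set Implicit Arguments.
Unset Strict Implicit.
Unset Printing Implicit Defensive.

Import GRing.Theory.
Local Open Scope ring_scope.
Local Open Scope classical_set_scope.

Notation "x %:F" := (@FracField.tofrac _ x) : ring_scope.

(* Subsets of the quotient field K = {fraction D}. The domain D is identified *)
(* with its image in K, so that ideals of D, fractional ideals and overrings  *)
(* all live in [set {fraction D}].                                            *)
Section Subsets.
Variable D : idomainType.
Local Notation K := {fraction D}.
Implicit Types (A B C M V : set K) (c x y : K).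

Definition dom_set : set K := range (@FracField.tofrac D).

Definition submod M : Prop :=
  [/\ M 0, forall x y, M x -> M y -> M (x + y)
    & forall (d : D) x, M x -> M (d%:F * x)].

Definition scale_set c A : set K := [set c * x | x in A].

(* The set of finite sums of products a * b with a in A and b in B. *)
Definition prod_set A B : set K :=
  [set x | exists2 s : seq (K * K), (forall p, p \in s -> A p.1 /\ B p.2)
                                  & x = \sum_(p <- s) p.1 * p.2].

Definition inv_set A : set K := [set x | scale_set x A `<=` dom_set].

Definition is_frac_ideal A : Prop :=
  [/\ submod A, exists2 x, A x & x != 0
    & exists2 d : D, d != 0 & scale_set d%:F A `<=` dom_set].

Definition overring V : Prop := subring_closed (mem V) /\ dom_set `<=` V.

Definition valuation_overring V : Prop :=
  overring V /\ (forall x, x != 0 -> V x \/ V x^-1).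

Definition valuation_ideal A : Prop :=
  [/\ submod A, A `<=` dom_set
    & exists2 V, valuation_overring V & prod_set A V `&` dom_set = A].

Definition valuation_element (a : D) : Prop :=
  [/\ a != 0, a \isn't a GRing.unit & valuation_ideal (scale_set a%:F dom_set)].

Lemma dom_submod : submod dom_set.
Proof.
split; first by exists 0; rewrite ?rmorph0.
- by move=> _ _ [a _ <-] [b _ <-]; exists (a + b); rewrite ?rmorphD.
- by move=> d _ [a _ <-]; exists (d * a); rewrite ?rmorphM.
Qed.

Lemma dom1 : dom_set 1.
Proof. by exists 1; rewrite ?rmorph1. Qed.

Lemma scale_submod c A : submod A -> submod (scale_set c A).
Proof.
case=> A0 AD AM; split; first by exists 0; rewrite ?mulr0.
- by move=> _ _ [a Aa <-] [b Ab <-]; exists (a + b); rewrite ?mulrDr //; apply: AD.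
- by move=> d _ [a Aa <-]; exists (d%:F * a); [apply: AM|rewrite mulrCA].
Qed.

Lemma preim_submod c A : submod A -> submod [set x | A (c * x)].
Proof.
case=> A0 AD AM; split => /=; first by rewrite mulr0.
- by move=> x y Ax Ay; rewrite mulrDr; apply: AD.
- by move=> d x Ax; rewrite mulrCA; apply: AM.
Qed.

Lemma prod_set_submod A B : submod A -> submod (prod_set A B).
Proof.
case=> A0 AD AM; split; first by exists [::]; rewrite ?big_nil.
- move=> _ _ [s sP ->] [t tP ->]; exists (s ++ t); last by rewrite big_cat.
  by move=> p; rewrite mem_cat => /orP[/sP|/tP].
- move=> d _ [s sP ->]; exists [seq (d%:F * p.1, p.2) | p <- s].
    by move=> _ /mapP[p /sP[Ap Bp] ->]; split => //=; apply: AM.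
  by rewrite big_map mulr_sumr; apply: eq_bigr => p _ /=; rewrite mulrA.
Qed.

Lemma prod_set_mem A B x y : A x -> B y -> prod_set A B (x * y).
Proof.
move=> Ax By; exists [:: (x, y)]; last by rewrite big_seq1.
by move=> p; rewrite inE => /eqP ->.
Qed.

Lemma prod_set_sub A B M : submod M ->
  (forall x y, A x -> B y -> M (x * y)) -> prod_set A B `<=` M.
Proof.
case=> M0 MD _ AB _ [s sP ->]; rewrite big_seq; elim/big_ind : _ => //.
by move=> p /sP[Ap Bp]; apply: AB.
Qed.

Lemma prod_setS A B A' B' :
  A `<=` A' -> B `<=` B' -> prod_set A B `<=` prod_set A' B'.
Proof. by move=> sA sB x [s sP ->]; exists s => // p /sP[/sA ? /sB]. Qed.

Lemma prod_setC A B : prod_set A B = prod_set B A.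
Proof.
suff H A' B' : prod_set A' B' `<=` prod_set B' A' by rewrite eqEsubset; split.
move=> _ [s sP ->]; exists [seq (p.2, p.1) | p <- s].
  by move=> _ /mapP[p /sP[Ap Bp] ->].
by rewrite big_map; apply: eq_bigr => p _ /=; rewrite mulrC.
Qed.

Lemma prod_setA A B C : submod A -> submod B -> submod C ->
  prod_set A (prod_set B C) = prod_set (prod_set A B) C.
Proof.
suff H A' B' C' : submod A' -> submod B' ->
    prod_set A' (prod_set B' C') `<=` prod_set (prod_set A' B') C'.
  move=> sA sB sC; rewrite eqEsubset; split; first exact: H.
  rewrite (prod_setC (prod_set A B)) (prod_setC A B).
  by rewrite (prod_setC A (prod_set B C)) (prod_setC B C); apply: H.
move=> sA sB; have sABC := prod_set_submod C' (prod_set_submod B' sA).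
apply: prod_set_sub => // x y Ax.
move: y; apply: (prod_set_sub (M := [set y | prod_set (prod_set A' B') C' (x * y)])).
  exact: preim_submod.
by move=> y z By Cz /=; rewrite mulrA; do 2?apply: prod_set_mem.
Qed.

Lemma prod_set1 A : submod A -> prod_set dom_set A = A.
Proof.
move=> sA; have [_ _ AM] := sA; rewrite eqEsubset; split.
  by apply: prod_set_sub => // _ y [d _ <-]; apply: AM.
by move=> x Ax; rewrite -[x]mul1r; apply: prod_set_mem => //; apply: dom1.
Qed.

Lemma frac_num_den x : exists2 q : D, q != 0 & dom_set (q%:F * x).
Proof.
elim/quotW : x => r; exists r.2; first exact: denom_ratioP.
exists r.1 => //; unlock FracField.tofrac.
rewrite -[RHS]FracField.pi_mul; apply/eqmodP => /=.
rewrite FracField.equivfE /FracField.mulf /=.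
by rewrite !numden_Ratio ?mulf_neq0 ?oner_neq0 ?denom_ratioP // !mul1r mulrC.
Qed.

End Subsets.

Arguments dom_set : clear implicits.

(* F(D): the nonzero fractional ideals of D. *)
Record fracIdeal (D : idomainType) := FracIdeal {
  fi_set :> set {fraction D};
  fi_proof : is_frac_ideal fi_set }.

Section FracIdealOps.
Variable D : idomainType.
Local Notation K := {fraction D}.
Implicit Types A B C : fracIdeal D.

Lemma fracIdeal_eq A B : A = B :> set K -> A = B.
Proof.
by case: A B => [A pA] [B pB] /= eAB; case: _ / eAB in pB *; congr FracIdeal.
Qed.

Lemma fi_submod A : submod A. Proof. by case: (fi_proof A). Qed.

Lemma fone_proof : is_frac_ideal (dom_set D).
Proof.
split; [exact: dom_submod | by exists 1; [exact: dom1|exact: oner_neq0] |].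
exists 1; first exact: oner_neq0.
by move=> _ [x dx <-]; rewrite rmorph1 mul1r.
Qed.
Definition fone : fracIdeal D := FracIdeal fone_proof.

Lemma fscale_proof (c : K) (c0 : c != 0) A : is_frac_ideal (scale_set c A).
Proof.
have [sA [a Aa a0] [d d0 dA]] := fi_proof A.
split; first exact: scale_submod.
  by exists (c * a); [exists a | rewrite mulf_neq0].
have [q q0 [r _ qc]] := frac_num_den c.
exists (d * q); first by rewrite mulf_neq0.
move=> _ [_ [x Ax <-] <-]; rewrite rmorphM mulrA -[_ * c]mulrA -qc.
rewrite mulrAC mulrC; have [_ _] := @dom_submod D; apply.
by apply: dA; exists x.
Qed.
Definition fscale (c : K) (c0 : c != 0) A : fracIdeal D :=
  FracIdeal (fscale_proof c0 A).

Definition fprinc (c : K) (c0 : c != 0) : fracIdeal D := fscale c0 fone.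

Lemma fmul_proof A B : is_frac_ideal (prod_set A B).
Proof.
have [sA [a Aa a0] [d d0 dA]] := fi_proof A.
have [sB [b Bb b0] [e e0 eB]] := fi_proof B.
split; first exact: prod_set_submod.
  by exists (a * b); [exact: prod_set_mem | rewrite mulf_neq0].
exists (d * e); first by rewrite mulf_neq0.
move=> _ [x ABx <-]; move: x ABx.
have sM := preim_submod (d * e)%:F (@dom_submod D).
apply: (prod_set_sub sM) => x y Ax By /=.
rewrite rmorphM mulrACA.
have [|u _ <-] := dA (d%:F * x); first by exists x.
by have [_ _] := @dom_submod D; apply; apply: eB; exists y.
Qed.
Definition fmul A B : fracIdeal D := FracIdeal (fmul_proof A B).

Lemma finv_proof A : is_frac_ideal (inv_set A).
Proof.
have [sA [a Aa a0] [d d0 dA]] := fi_proof A.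
have [D0 DD DM] := @dom_submod D.
split; first split.
- by move=> _ [x _ <-]; rewrite mul0r.
- move=> x y Ax Ay _ [z Az <-]; rewrite mulrDl.
  by apply: DD; [apply: Ax | apply: Ay]; exists z.
- move=> e x Ax _ [z Az <-]; rewrite -mulrA; apply: DM.
  by apply: Ax; exists z.
- by exists d%:F; rewrite ?tofrac_eq0.
have [|e _ de] := dA (d%:F * a); first by exists a.
exists e; first by rewrite -tofrac_eq0 de mulf_neq0 ?tofrac_eq0.
move=> _ [x Ax <-]; rewrite de -mulrA [a * x]mulrC; apply: DM.
by apply: Ax; exists a.
Qed.
Definition finv A : fracIdeal D := FracIdeal (finv_proof A).

Definition finitely_generated A : Prop :=
  exists s : seq K, A = prod_set (dom_set D) [set` s] :> set K.

Lemma fmulC : commutative fmul.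
Proof. by move=> A B; apply: fracIdeal_eq; apply: prod_setC. Qed.

Lemma fmulA : associative fmul.
Proof.
by move=> A B C; apply: fracIdeal_eq; apply: prod_setA; apply: fi_submod.
Qed.

Lemma fmul1 : left_id fone fmul.
Proof.
by move=> A; apply: fracIdeal_eq; apply: prod_set1; apply: fi_submod.
Qed.

HB.instance Definition _ :=
  Monoid.isComLaw.Build (fracIdeal D) fone fmul fmulA fmulC fmul1.

Lemma fmul_mem A B (x y : K) :
  fi_set A x -> fi_set B y -> fi_set (fmul A B) (x * y).
Proof. exact: prod_set_mem. Qed.

Lemma fmul_sub A B C :
  (forall x y : K, fi_set A x -> fi_set B y -> fi_set C (x * y)) -> fmul A B `<=` C.
Proof. exact: prod_set_sub (fi_submod C). Qed.

Lemma fmulS A B A' B' : A `<=` A' -> B `<=` B' -> fmul A B `<=` fmul A' B'.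
Proof. exact: prod_setS. Qed.

Lemma fmulV_sub A : fmul A (finv A) `<=` fone.
Proof. by apply: fmul_sub => x y Ax; apply; exists x; rewrite // mulrC. Qed.

Lemma finv_sub A B : fmul A B `<=` fone -> B `<=` finv A.
Proof.
by move=> AB y By _ [x Ax <-]; apply: AB; rewrite mulrC; apply: fmul_mem.
Qed.

Lemma fscaleM (c : K) (c0 : c != 0) A : fscale c0 A = fmul (fprinc c0) A.
Proof.
apply: fracIdeal_eq; rewrite eqEsubset; split.
  move=> _ [x Ax <-]; apply: prod_set_mem => //.
  by exists 1; rewrite ?mulr1 //; apply: dom1.
apply: prod_set_sub; first exact: scale_submod (fi_submod A).
move=> _ x [_ [d _ <-] <-] Ax; exists (d%:F * x); last by rewrite mulrA.
by have [_ _] := fi_submod A; apply.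
Qed.

Lemma fprincM (c e ce : K) (c0 : c != 0) (e0 : e != 0) (ce0 : ce != 0) :
  ce = c * e -> fmul (fprinc c0) (fprinc e0) = fprinc ce0.
Proof.
move=> ceE; rewrite -fscaleM; apply: fracIdeal_eq; rewrite /= /scale_set.
rewrite ceE eqEsubset; split.
  by move=> _ [_ [x Dx <-] <-]; exists x; rewrite ?mulrA.
by move=> _ [x Dx <-]; exists (e * x); [exists x | rewrite mulrA].
Qed.

Lemma fprinc1 (c0 : (1 : K) != 0) : fprinc c0 = fone.
Proof.
apply: fracIdeal_eq; rewrite eqEsubset; split=> [_ [x Dx <-]|x Dx] /=.
  by rewrite mul1r.
by exists x; rewrite ?mul1r.
Qed.

End FracIdealOps.

Record starOp (D : idomainType) := StarOp {
  star :> fracIdeal D -> fracIdeal D;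
  star_ext : forall A : fracIdeal D, A `<=` star A;
  star_idem : forall A : fracIdeal D, star (star A) = star A;
  star_mono : forall A B : fracIdeal D, A `<=` B -> star A `<=` star B;
  star_scale : forall (c : {fraction D}) (c0 : c != 0) (A : fracIdeal D),
    star (fscale c0 A) = fscale c0 (star A);
  star_one : star (fone D) = fone D }.

Section StarTheory.
Variables (D : idomainType) (s : starOp D).
Implicit Types A B I : fracIdeal D.

Definition finite_type : Prop := forall A : fracIdeal D,
  s A = \bigcup_(C in [set C : fracIdeal D | finitely_generated C /\ C `<=` A]) s C
    :> set {fraction D}.

Definition star_ideal I : Prop := s I = I.

Definition star_invertible I : Prop := s (fmul I (finv I)) = fone D.

Lemma star_eqP A B : A `<=` s B -> B `<=` s A -> s A = s B.
Proof.
move=> AB BA; apply: fracIdeal_eq; rewrite eqEsubset.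
by split; [rewrite -(star_idem s B) | rewrite -(star_idem s A)]; apply: star_mono.
Qed.

Lemma star_sub A B : A `<=` s B -> s A `<=` s B.
Proof. by move=> AB; rewrite -(star_idem s B); apply: star_mono. Qed.

Lemma star_mul_sub A B : fmul (s A) B `<=` s (fmul A B).
Proof.
apply: fmul_sub => x y sAx By.
have [-> | y0] := eqVneq y 0; first by rewrite mulr0; case: (fi_submod (s (fmul A B))).
suff: s (fscale y0 A) `<=` s (fmul A B).
  by rewrite star_scale; apply; exists x; rewrite // mulrC.
apply: star_mono => _ [a Aa <-]; rewrite mulrC; exact: fmul_mem.
Qed.

Lemma star_mull A B : s (fmul (s A) B) = s (fmul A B).
Proof.
apply: star_eqP; first exact: star_mul_sub.
apply: (subset_trans _ (@star_ext _ s (fmul (s A) B))).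
by apply: fmulS => //; apply: star_ext.
Qed.

Lemma star_mulr A B : s (fmul A (s B)) = s (fmul A B).
Proof. by rewrite fmulC star_mull fmulC. Qed.

Lemma star_invertible_witness A B :
  fmul A B `<=` fone D -> s (fmul A B) = fone D -> star_invertible A.
Proof.
move=> AB sAB; apply: fracIdeal_eq; rewrite eqEsubset; split.
  rewrite -[X in _ `<=` X](congr1 _ (star_one s)).
  by apply: star_mono; apply: fmulV_sub.
rewrite -[X in X `<=` _](congr1 _ sAB); apply: star_mono.
by apply: fmulS => //; apply: finv_sub.
Qed.

(* The group T_*(D) of *-invertible fractional *-ideals. Its law (I, J) |->   *)
(* (IJ)_* is written additively because the library's abelian groups          *)
(* ([zmodType]) are additive: 0 is D, - I is I^-1, I *+ n is (I^n)_*.         *)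
Record invIdeal := InvIdeal {
  inv_val :> fracIdeal D;
  inv_star_ideal : star_ideal inv_val;
  inv_star_invertible : star_invertible inv_val }.

HB.instance Definition _ := gen_eqMixin invIdeal.
HB.instance Definition _ := gen_choiceMixin invIdeal.

Implicit Types X Y Z : invIdeal.

Lemma invIdeal_eq X Y : inv_val X = inv_val Y -> X = Y.
Proof.
case: X Y => [X pX qX] [Y pY qY] /= eXY.
by case: _ / eXY in pY qY *; congr InvIdeal; apply: Prop_irrelevance.
Qed.

Lemma invI_zero_ideal : star_ideal (fone D). Proof. exact: star_one. Qed.
Lemma invI_zero_inv : star_invertible (fone D).
Proof.
by apply: (@star_invertible_witness _ (fone D)); rewrite fmul1 ?star_one.
Qed.
Definition invI_zero : invIdeal := InvIdeal invI_zero_ideal invI_zero_inv.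

Lemma invI_opp_ideal X : star_ideal (finv X).
Proof.
apply: fracIdeal_eq; rewrite eqEsubset; split; last exact: star_ext.
apply: finv_sub; rewrite fmulC; apply: subset_trans (@star_mul_sub _ _) _.
by rewrite fmulC inv_star_invertible.
Qed.
Lemma invI_opp_inv X : star_invertible (finv X).
Proof.
apply: (@star_invertible_witness _ X); rewrite fmulC; first exact: fmulV_sub.
exact: inv_star_invertible.
Qed.
Definition invI_opp X : invIdeal := InvIdeal (invI_opp_ideal X) (invI_opp_inv X).

Lemma invI_add_ideal X Y : star_ideal (s (fmul X Y)).
Proof. exact: star_idem. Qed.
Lemma invI_add_inv X Y : star_invertible (s (fmul X Y)).
Proof.
have e : s (fmul (s (fmul X Y)) (fmul (finv X) (finv Y))) = fone D.
  rewrite star_mull.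
  have -> : fmul (fmul X Y) (fmul (finv X) (finv Y)) =
            fmul (fmul X (finv X)) (fmul Y (finv Y)).
    by rewrite -!fmulA; congr fmul; rewrite !fmulA [fmul Y _]fmulC.
  rewrite -star_mull -star_mulr !inv_star_invertible fmul1.
  exact: star_one.
apply: star_invertible_witness (e).
by rewrite -[X in _ `<=` X](congr1 _ e); apply: star_ext.
Qed.
Definition invI_add X Y : invIdeal :=
  InvIdeal (invI_add_ideal X Y) (invI_add_inv X Y).

Lemma invI_addA : associative invI_add.
Proof.
by move=> X Y Z; apply: invIdeal_eq => /=; rewrite star_mull star_mulr fmulA.
Qed.

Lemma invI_addC : commutative invI_add.
Proof. by move=> X Y; apply: invIdeal_eq => /=; rewrite fmulC. Qed.

Lemma invI_add0 : left_id invI_zero invI_add.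
Proof.
by move=> X; apply: invIdeal_eq => /=; rewrite fmul1; apply: inv_star_ideal.
Qed.

Lemma invI_addN : left_inverse invI_zero invI_opp invI_add.
Proof.
move=> X; apply: invIdeal_eq => /=; rewrite fmulC; exact: inv_star_invertible.
Qed.

HB.instance Definition _ :=
  GRing.isZmodule.Build invIdeal invI_addA invI_addC invI_add0 invI_addN.

Definition principal : {pred invIdeal} := fun X =>
  `[< exists (c : {fraction D}) (c0 : c != 0), inv_val X = fprinc c0 >].

Lemma principal_zmod_closed : zmod_closed principal.
Proof.
split.
  by apply/asboolP; exists 1, (oner_neq0 _); rewrite fprinc1.
move=> X Y /asboolP[c [c0 Xc]] /asboolP[e [e0 Ye]]; apply/asboolP.
have ei0 : e^-1 != 0 by rewrite invr_eq0.
have ce0 : c / e != 0 by rewrite mulf_neq0.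
exists (c / e), ce0; rewrite /= Xc.
suff -> : finv Y = fprinc ei0.
  by rewrite (fprincM _ _ ce0) // /fprinc star_scale star_one.
rewrite Ye; apply: fracIdeal_eq; rewrite eqEsubset; split.
  move=> x ex; exists (e * x); last by rewrite mulrA mulVf ?mul1r.
  by apply: ex; exists e; [exists 1; [exact: dom1|rewrite mulr1]|rewrite mulrC].
by apply: finv_sub; rewrite (fprincM _ _ (oner_neq0 _)) ?divff // fprinc1.
Qed.

HB.instance Definition _ :=
  GRing.isZmodClosed.Build invIdeal principal principal_zmod_closed.

End StarTheory.

Arguments principal {D} s _.

(* Cl_*(D) = T_*(D) / Prin(D); [principal s] is only a subgroup: despite its   *)
(* name, [ideal_quot] is the quotient of a [zmodType] by any [zmodClosed].     *)
Definition class_group (D : idomainType) (s : starOp D) : zmodType :=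
  {ideal_quot (principal s)}.

Definition torsion_group (G : zmodType) : Prop :=
  forall x : G, exists2 n : nat, (0 < n)%N & x *+ n = 0.

(* The factors are nonzero: the star operation, hence the right-hand side, is *)
(* only defined on F(D).                                                      *)
Definition VIFD (D : idomainType) (s : starOp D) : Prop :=
  forall (c : {fraction D}) (c0 : c != 0), dom_set D c ->
  exists (n : nat) (I : 'I_n -> fracIdeal D),
    [/\ (0 < n)%N, forall i, valuation_ideal (I i)
      & fprinc c0 = s (\big[@fmul D/fone D]_(i < n) I i)].

Definition AVFD (D : idomainType) : Prop :=
  forall a : D, a != 0 -> a \isn't a GRing.unit ->
  exists2 n : nat, (0 < n)%N &
    exists2 t : seq D, {in t, forall x, valuation_element x}
                     & a ^+ n = \prod_(x <- t) x.

(* Main.v *)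
Require Import Defs.
From mathcomp Require Import all_boot all_order all_algebra.
From mathcomp Require Import boolp classical_sets.

(** The heart of the matter is that a power of a *-invertible valuation ideal
    that becomes principal is generated by a valuation element or a unit.  Let
    [I = IV `&` D] be *-invertible with [(I^n)_* = bD].  The ring [V] itself may
    be too small to give [bV `&` D = bD], because its centre need not see *; the
    remedy is to enlarge it to
      [W = {w | ((V :_D w) + I)_* = D}],
    which in the finite type case is the intersection of the localizations of
    [V] at the *-maximal ideals containing [I].  If [w] is in [W] and
    [I w `<=` D], put [A = (V :_D w)]; then [A w I `<=` I V `&` D = I], so
    [A w I I^-1 `<=` D], hence [A w `<=` D] as [I] is *-invertible, hence
    [(A + I) w `<=` D] and so [w] is in [D] ([enlarged_int1]).  Peeling off one
    factor [I] at a time, [I^n w `<=` D] also forces [w] in [D]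
    ([enlarged_int]), which for [w = x / b] says exactly that
    [bW `&` D = bD] ([valuation_ideal_root]).

    The rest is bookkeeping in the group of *-invertible *-ideals.  If
    [aD = (I_1 ... I_k)_*], each [I_i] is *-invertible; torsion of the class
    group gives a common exponent [N > 0] such that each [(I_i^N)_*] is
    principal, say [d_i D].  Then [a^N] is a unit times [d_1 ... d_k], every
    [d_i] is a unit or a valuation element, and the units are absorbed by one
    of the valuation elements. *)

Set Implicit Arguments.
Unset Strict Implicit.
Unset Printing Implicit Defensive.

Import GRing.Theory.
Local Open Scope ring_scope.
Local Open Scope classical_set_scope.

(** * Integral elements of the quotient field *)

Section DomSet.
Variable D : idomainType.
Local Notation K := {fraction D}.
Implicit Types x y : K.

Lemma dom_set_frac (d : D) : dom_set D d%:F.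
Proof. by exists d. Qed.

Lemma dom_setD x y : dom_set D x -> dom_set D y -> dom_set D (x + y).
Proof. by case: (@dom_submod D) => _ DD _; apply: DD. Qed.

Lemma dom_setM x y : dom_set D x -> dom_set D y -> dom_set D (x * y).
Proof. by move=> [d _ <-] [e _ <-]; rewrite -rmorphM; apply: dom_set_frac. Qed.

Lemma submodD (M : set K) x y : submod M -> M x -> M y -> M (x + y).
Proof. by case=> _ MD _; apply: MD. Qed.

Lemma submodM (M : set K) x y : submod M -> dom_set D x -> M y -> M (x * y).
Proof. by case=> _ _ MM [d _ <-]; apply: MM. Qed.

End DomSet.

(** * Overrings *)

Section Overrings.
Variables (D : idomainType) (V : set {fraction D}).
Hypothesis V_over : overring V.

Lemma overring_dom x : dom_set D x -> V x.
Proof. by case: V_over => _; apply. Qed.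

Lemma overringM x y : V x -> V y -> V (x * y).
Proof. by case: V_over => -[_ _ VM] _ Vx Vy; have := VM x y; rewrite !inE; apply. Qed.

Lemma overringN x : V x -> V (- x).
Proof.
move=> Vx; rewrite -mulN1r; apply: overringM => //; apply: overring_dom.
by exists (-1); rewrite ?rmorphN ?rmorph1.
Qed.

Lemma overringD x y : V x -> V y -> V (x + y).
Proof.
move=> Vx Vy; case: V_over => -[_ VB _] _.
by have := VB x (- y); rewrite !inE opprK; apply => //; apply: overringN.
Qed.

Lemma overring_submod : submod V.
Proof.
split; first by apply: overring_dom; exists 0; rewrite ?rmorph0.
  exact: overringD.
by move=> d x; apply: overringM; apply/overring_dom/dom_set_frac.
Qed.

End Overrings.

(** * Enlarging a valuation overring *)

Lemma star_dom D (s : starOp D) (A : fracIdeal D) :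
  A `<=` dom_set D -> s A `<=` dom_set D.
Proof.
move=> AD; rewrite -[X in _ `<=` X](congr1 (@fi_set D) (star_one s)).
exact: star_mono.
Qed.

Lemma mulrn_dom D (s : starOp D) (X : invIdeal s) n :
  X `<=` dom_set D -> X *+ n `<=` dom_set D.
Proof.
move=> XD; elim: n => [|n IHn]; first by rewrite mulr0n.
rewrite mulrS; apply: star_dom.
by apply: (@fmul_sub _ _ _ (fone D)) => x y /XD Dx /IHn; apply: dom_setM.
Qed.

Section Enlarge.
Variables (D : idomainType) (s : starOp D).
Local Notation K := {fraction D}.

(** [A w `<=` D] passes to *-closures.  Applied to [A = I I^-1], this is how
    *-invertibility gets used. *)
Lemma dom_set_star_one (A : fracIdeal D) (w : K) :
  s A = fone D -> (forall a, fi_set A a -> dom_set D (a * w)) -> dom_set D w.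
Proof.
move=> sA Aw.
have [-> | w0] := eqVneq w 0; first by exists 0; rewrite ?rmorph0.
have sub : s (fscale w0 A) `<=` s (fone D).
  by apply: star_mono => _ [a Aa <-]; rewrite mulrC; apply: Aw.
move: sub; rewrite star_scale sA star_one; apply.
by exists 1; [exact: dom1 | rewrite mulr1].
Qed.

Variables (V : set K) (I : fracIdeal D).

(** The ideal [(V :_D w) + I]. *)
Definition conductor_sum (w : K) : set K :=
  [set x | exists c i, [/\ dom_set D c, V (c * w), fi_set I i & x = c + i]].

(** The star operation is only defined on fractional ideals, and it is enough
    that [conductor_sum w] contain one whose *-closure is [D]. *)
Definition enlarged : set K :=
  [set w | exists2 A : fracIdeal D, A `<=` conductor_sum w & s A = fone D].

Hypotheses (V_over : overring V) (ID : I `<=` dom_set D).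

Lemma conductor_sum_submod w : submod (conductor_sum w).
Proof.
have [I0 _ _] := fi_submod I; have [V0 _ _] := overring_submod V_over.
split.
- exists 0, 0; split=> //; rewrite ?addr0 ?mul0r //.
  by exists 0; rewrite ?rmorph0.
- move=> _ _ [c [i [Dc Vc Ii ->]]] [e [j [De Ve Ij ->]]].
  exists (c + e), (i + j); split.
  + exact: dom_setD.
  + by rewrite mulrDl; apply: overringD.
  + by apply: submodD Ii Ij; apply: fi_submod.
  + by rewrite addrACA.
- move=> d _ [c [i [Dc Vc Ii ->]]].
  exists (d%:F * c), (d%:F * i); split.
  + exact/dom_setM/Dc/dom_set_frac.
  + rewrite -mulrA; apply: overringM => //.
    by apply: overring_dom => //; apply: dom_set_frac.
  + by apply: submodM Ii; [apply: fi_submod | apply: dom_set_frac].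
  + by rewrite mulrDr.
Qed.

Lemma sub_enlarged : V `<=` enlarged.
Proof.
move=> w Vw; exists (fone D); last exact: star_one.
move=> d Dd; exists d, 0; split=> //; rewrite ?addr0 //.
  by apply: overringM => //; apply: overring_dom.
by case: (fi_submod I).
Qed.

(** Covers both differences and products of [w] and [w']: if [A] and [B] witness
    [w] and [w'], then [A B] witnesses [u], because a product of two elements of
    [(V :_D w) + I] and [(V :_D w') + I] is a product of conductors modulo [I]. *)
Lemma enlarged_comb w w' u :
  (forall c c', dom_set D c -> dom_set D c' ->
     V (c * w) -> V (c' * w') -> V (c * c' * u)) ->
  enlarged w -> enlarged w' -> enlarged u.
Proof.
move=> comb [A Aw sA] [B Bw sB]; exists (fmul A B); last first.
  by rewrite -star_mull sA fmul1.
apply: prod_set_sub => [|x y Ax By]; first exact: conductor_sum_submod.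
have [c [i [Dc Vc Ii ->]]] := Aw _ Ax.
have [e [j [De Ve Ij ->]]] := Bw _ By.
exists (c * e), (c * j + i * (e + j)); split.
- exact: dom_setM.
- exact: comb.
- have sI := fi_submod I; apply: submodD => //; first exact: submodM.
  by rewrite mulrC; apply: submodM => //; apply: dom_setD => //; apply: ID.
- by rewrite mulrDl mulrDr addrA.
Qed.

Lemma enlarged_overring : overring enlarged.
Proof.
have V1 : V 1 by apply: overring_dom => //; apply: dom1.
split; last exact: subset_trans (overring_dom V_over) sub_enlarged.
split=> [|w w'|w w']; rewrite !inE; first exact: sub_enlarged.
- apply: enlarged_comb => c e Dc De Vc Ve; rewrite mulrBr.
  apply: overringD => //; last apply: overringN => //.
    by rewrite mulrAC mulrC; apply: overringM => //; apply: overring_dom.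
  by rewrite -mulrA; apply: overringM => //; apply: overring_dom.
- by apply: enlarged_comb => c e _ _ Vc Ve; rewrite mulrACA; apply: overringM.
Qed.

Hypothesis IV : prod_set I V `&` dom_set D `<=` I.
Variable X : invIdeal s.
Hypothesis sI : inv_val X = s I.

Lemma enlarged_int1 w :
  enlarged w -> (forall x, fi_set X x -> dom_set D (x * w)) -> dom_set D w.
Proof.
move=> [A Aw sA] Xw.
have Iw i : fi_set I i -> dom_set D (i * w).
  by move=> Ii; apply: Xw; rewrite sI; apply: star_ext.
apply: dom_set_star_one sA _ => _ /Aw[c [i [Dc Vc Ii ->]]].
rewrite mulrDl; apply: dom_setD; last exact: Iw.
(* [c w] sends [I] into [I V `&` D = I], hence [I X^-1] into [D]. *)
have sIX : s (fmul I (Defs.finv X)) = fone D.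
  by rewrite -star_mull -sI inv_star_invertible.
apply: dom_set_star_one sIX _ => x.
move: x; apply: (prod_set_sub (M := [set x | dom_set D (x * (c * w))])).
  under eq_set do rewrite mulrC.
  exact/preim_submod/dom_submod.
move=> i' y Ii' Xy /=; rewrite mulrAC mulrC; apply: Xy.
exists (i' * (c * w)); last by rewrite mulrC.
rewrite sI; apply: star_ext; apply: IV; split; first exact: prod_set_mem.
by rewrite mulrCA; apply: dom_setM => //; apply: Iw.
Qed.

(** If [X^(n+1) w `<=` D], then for [z] in [X^n] the element [z w] falls under
    the case of a single factor, so [X^n w `<=` D]. *)
Lemma enlarged_int n w :
  enlarged w -> (forall x, fi_set (X *+ n) x -> dom_set D (x * w)) -> dom_set D w.
Proof.
elim: n => [|n IHn] in w * => Ww Xw.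
  by rewrite -[w]mul1r; apply: Xw; rewrite mulr0n; apply: dom1.
have XnD : X *+ n `<=` dom_set D.
  by apply: mulrn_dom; rewrite sI; apply: star_dom.
apply: IHn => // z Xz; apply: enlarged_int1 => [|x Xx].
  apply: (overringM enlarged_overring) => //.
  by apply: (overring_dom enlarged_overring); apply: XnD.
by rewrite mulrA; apply: Xw; rewrite mulrS; apply: star_ext; apply: fmul_mem.
Qed.

End Enlarge.

Section Factorization.
Variables (D : idomainType) (s : starOp D).
Local Notation K := {fraction D}.
Implicit Types (X Y : invIdeal s) (c e : K).

(** * Generators of principal ideals *)

Definition generates X c : Prop := exists c0 : c != 0, inv_val X = fprinc c0.

Lemma generates0 : generates 0 1.
Proof. by exists (oner_neq0 _); rewrite fprinc1. Qed.

Lemma generatesD X Y c e :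
  generates X c -> generates Y e -> generates (X + Y) (c * e).
Proof.
move=> [c0 Xc] [e0 Ye]; have ce0 : c * e != 0 by rewrite mulf_neq0.
exists ce0; rewrite /= Xc Ye (fprincM c0 e0 ce0) //.
by rewrite /fprinc star_scale star_one.
Qed.

Lemma generatesMn X c n : generates X c -> generates (X *+ n) (c ^+ n).
Proof.
move=> Xc; elim: n => [|n IHn]; first exact: generates0.
by rewrite mulrS exprS; apply: generatesD.
Qed.

Lemma generates_mem X c : generates X c -> fi_set X c.
Proof. by move=> [c0 ->]; exists 1; [exact: dom1 | rewrite mulr1]. Qed.

Lemma generates_dvd X c e :
  generates X c -> generates X e -> exists u : D, c = u%:F * e.
Proof.
move=> /generates_mem Xc [e0 Xe]; move: Xc; rewrite Xe => -[_ [u _ <-] <-].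
by exists u; rewrite mulrC.
Qed.

Lemma generates_assoc X (a b : D) : generates X a%:F -> generates X b%:F ->
  exists2 u : D, u \is a GRing.unit & a = u * b.
Proof.
move=> Xa Xb.
have [u /eqP] := generates_dvd Xa Xb; rewrite -rmorphM tofrac_eq => /eqP ab.
have [v /eqP] := generates_dvd Xb Xa; rewrite -rmorphM tofrac_eq => /eqP ba.
exists u => //; apply/unitrPr; exists v.
have [b0 _] := Xb; rewrite tofrac_eq0 in b0.
by apply: (mulIf b0); rewrite mul1r {2}ba ab mulrCA mulrA.
Qed.

(** * Valuation ideals and valuation elements *)

(** A principal power of a *-invertible valuation ideal is a valuation ideal,
    witnessed by the enlarged valuation ring. *)
Lemma valuation_ideal_root (I : fracIdeal D) X n (d : D) :
    valuation_ideal I -> inv_val X = s I -> generates (X *+ n) d%:F ->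
  valuation_ideal (scale_set d%:F (dom_set D)).
Proof.
move=> [_ ID [V [V_over V_val] IV]] sI [d0 Xd].
have W_over := enlarged_overring s V_over ID.
have dD : scale_set d%:F (dom_set D) `<=` dom_set D.
  by move=> _ [x Dx <-]; apply: dom_setM => //; apply: dom_set_frac.
have sub : V `<=` enlarged s V I := sub_enlarged _ _ V_over.
split=> //; first exact/scale_submod/dom_submod.
exists (enlarged s V I).
  by split=> // x /V_val[] /sub; [left | right].
rewrite eqEsubset; split=> [x [xdW Dx] | x dx]; last first.
  split; last exact: dD.
  rewrite -[x]mulr1; apply: prod_set_mem => //.
  by apply: (overring_dom W_over); apply: dom1.
have [w Ww xE] : scale_set d%:F (enlarged s V I) x.
  move: x xdW {Dx}; apply: prod_set_sub.
    exact/scale_submod/overring_submod.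
  move=> _ w [e De <-] Ww; exists (e * w); last by rewrite mulrA.
  by apply: (overringM W_over) => //; apply: (overring_dom W_over).
exists w => //; apply: (enlarged_int (s := s) V_over ID _ sI (n := n)) => //.
  by rewrite IV.
rewrite Xd => _ [e De <-]; rewrite mulrAC xE.
exact: dom_setM.
Qed.

Lemma valuation_elementM (u a : D) : u \is a GRing.unit ->
  valuation_element a -> valuation_element (u * a).
Proof.
move=> uU [a0 aU va]; split.
- by rewrite mulf_neq0 // (contraTneq _ uU) // => ->; rewrite unitr0.
- by rewrite unitrMr.
- suff -> : scale_set (u * a)%:F (dom_set D) = scale_set a%:F (dom_set D) by [].
  rewrite eqEsubset; split=> _ [_ [e _ <-] <-].
    exists (u * e)%:F; first exact: dom_set_frac.
    by rewrite -!rmorphM mulrA [a * u]mulrC.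
  exists (u^-1 * e)%:F; first exact: dom_set_frac.
  by rewrite -!rmorphM [u * a]mulrC mulrA mulrK.
Qed.

(** Unit factors are absorbed by one of the other factors, of which there is at
    least one as the product is not a unit. *)
Lemma prod_valuation_elements k (d : 'I_k -> D) (u a : D) :
    u \is a GRing.unit -> a \isn't a GRing.unit -> a = u * \prod_i d i ->
    (forall i, d i \isn't a GRing.unit -> valuation_element (d i)) ->
  exists2 t : seq D, {in t, forall x, valuation_element x} & a = \prod_(x <- t) x.
Proof.
move=> uU aU aE dP.
pose t := [seq d j | j <- enum 'I_k & d j \isn't a GRing.unit].
pose v := u * \prod_(i | d i \is a GRing.unit) d i.
have vU : v \is a GRing.unit.
  by rewrite unitrM uU; apply: rpred_prod.
have tP : {in t, forall x, valuation_element x}.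
  by move=> x /mapP[i + ->]; rewrite mem_filter => /andP[/dP].
have {}aE : a = v * \prod_(x <- t) x.
  rewrite aE (bigID (fun i => d i \is a GRing.unit)) mulrA big_map big_filter.
  by rewrite big_enum_cond.
case: t => [|x t] in tP aE *.
  by rewrite aE big_nil mulr1 vU in aU.
exists (v * x :: t); last by rewrite aE !big_cons mulrA.
move=> y; rewrite inE => /orP[/eqP -> | yt].
  by apply: valuation_elementM => //; apply: tP; rewrite mem_head.
by apply: tP; rewrite inE yt orbT.
Qed.

(** * Factorizations in the group of *-invertible *-ideals *)

Lemma star_factor_invertible k (I : 'I_k -> fracIdeal D) c (c0 : c != 0) :
    fprinc c0 = s (\big[@fmul D/fone D]_i I i) ->
  forall i, star_invertible s (s (I i)).
Proof.
move=> cI i; have ci0 : c^-1 != 0 by rewrite invr_eq0.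
(* [I i * B = c D * c^-1 D] up to *-closure. *)
pose B := fmul (\big[@fmul D/fone D]_(j | j != i) I j) (fprinc ci0).
have e : s (fmul (s (I i)) B) = fone D.
  rewrite star_mull fmulA; have := bigD1 (op := @fmul D) (F := I) i isT.
  move=> /= <-; rewrite -star_mull -cI.
  by rewrite (fprincM _ _ (oner_neq0 _)) ?divff // fprinc1 star_one.
apply: star_invertible_witness (e).
by rewrite -[X in _ `<=` X](congr1 (@fi_set D) e); apply: star_ext.
Qed.

Lemma torsion_principal X : torsion_group (class_group s) ->
  exists2 n, (0 < n)%N & X *+ n \in principal s.
Proof.
move=> /(_ (\pi_{ideal_quot (principal s)} X)%qT)[n n0 Xn]; exists n => //.
rewrite -[X *+ n]subr0 Quotient.idealrBE.
by apply/eqP; rewrite raddfMn raddf0.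
Qed.

End Factorization.

Theorem proposition5p5 (D : idomainType) (s : starOp D)
    (s_fin : finite_type s) (D_vifd : VIFD s)
    (Cl_tors : torsion_group (class_group s)) :
  AVFD D.
Proof.
move=> a a0 aU; have a0F : a%:F != 0 by rewrite tofrac_eq0.
have [k [I [_ I_val aI]]] := D_vifd _ a0F (dom_set_frac a).
pose X i := InvIdeal (star_idem s (I i)) (star_factor_invertible aI i).
have sumX : generates (\sum_i X i) a%:F.
  exists a0F; rewrite aI.
  elim/big_ind2: _ => //; first by rewrite star_one.
  by move=> Y A Z B /= YA ZB; rewrite YA ZB star_mull star_mulr.
have [m m0 mP] := fin_all_exists2 (fun i => torsion_principal (X i) Cl_tors).
(* One exponent for all the factors. *)
pose N := (\prod_i m i)%N.
have dE i : exists e : D, generates (X i *+ N) e%:F.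
  have : X i *+ N \in principal s.
    by rewrite /N (bigD1 i) //= mulrnA rpredMn.
  move=> /asboolP Xc; have [c Xic] : exists c, generates (X i *+ N) c by [].
  have XD : X i *+ N `<=` dom_set D.
    by have [_ ID _] := I_val i; apply: mulrn_dom; apply: star_dom.
  by have [d _ dc] := XD _ (generates_mem Xic); exists d; rewrite dc.
have [d dP] := fin_all_exists dE.
exists N; first by rewrite prodn_gt0.
have Xa : generates (\sum_i X i *+ N) (a ^+ N)%:F.
  by rewrite sumrMnl rmorphXn; apply: generatesMn.
have Xd : generates (\sum_i X i *+ N) (\prod_i d i)%:F.
  rewrite rmorph_prod; elim/big_ind2: _ => //; first exact: generates0.
  by move=> *; apply: generatesD.
have [u uU aE] := generates_assoc Xa Xd.
apply: prod_valuation_elements uU _ aE _.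
  by rewrite unitrX_pos ?prodn_gt0.
move=> i diU; split=> //.
  by have [di0 _] := dP i; rewrite tofrac_eq0 in di0.
exact: (valuation_ideal_root (X := X i)) (I_val i) _ (dP i).
Qed.
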